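(* Let $A,B,C$ be complex vector spaces of the same finite dimension $m$, and let $T\in A\otimes B\otimes C$ be a concise tensor with flattening $T_A:A^*\to B\otimes C$. If $T$ is of degenerate geometric rank and $r=1$ is the only $r$ for which the rank $r$ locus of $T$ achieves $\mathrm{GR}(T)$, then $\mathbb{P}T_A(A^* )$ contains a positive-dimensional linear subspace of $\mathbb{P}(B\otimes C)$ that is contained in the Segre variety $\mathrm{Seg}(\mathbb{P}B\times\mathbb{P}C)$.
   Context: Everything is over $\mathbb{C}$. For $T\in A\otimes B\otimes C$ the flattenings are the induced linear maps $T_A:A^*\to B\otimes C$, $T_B:B^*\to A\otimes C$, $T_C:C^*\to A\otimes B$; $T$ is concise if all three are injective. Elements of $B\otimes C=\mathrm{Hom}(B^*,C)$ are regarded as matrices, and $\mathrm{Seg}(\mathbb{P}B\times\mathbb{P}C)\subseteq\mathbb{P}(B\otimes C)$ is the Segre variety of classes of rank $1$ matrices. The rank $r$ locus of $T$ is $Y^r_T:=\{[\alpha]\in\mathbb{P}A^*\mid \mathrm{rank}\,T_A(\alpha)\le r\}\subseteq\mathbb{P}A^*$. The geometric rank of $T$ is $$\mathrm{GR}(T):=\min_{r\ge0}\bigl(\mathrm{codim}_{\mathbb{P}A^*}(Y^r_T)+r\bigr),$$ with the convention $\dim\emptyset=-1$ (so the empty set has codimension $\dim A$ in $\mathbb{P}A^*$). One says that the rank $r$ locus $Y^r_T$ (or the integer $r$) achieves $\mathrm{GR}(T)$ if $\mathrm{GR}(T)=\mathrm{codim}_{\mathbb{P}A^*}(Y^r_T)+r$.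 The tensor $T$ has degenerate geometric rank if $\mathrm{GR}(T)<\min\{\dim A,\dim B,\dim C\}$. *)

(* Defs.v *)
From HB Require Import structures.
From mathcomp Require Import all_boot all_order all_algebra.
From mathcomp Require Import boolp classical_sets reals.
From mathcomp Require Import complex mpoly.

Set Implicit Arguments.
Unset Strict Implicit.
Unset Printing Implicit Defensive.

Import Order.TTheory GRing.Theory Num.Theory.

Local Open Scope classical_set_scope.
Local Open Scope ring_scope.

(* The space P(K^n) is represented by the nonzero vectors of K^n: a subset of
   P(K^n) is given by the set of its nonzero representatives. *)
Section ProjectiveDimension.
Variables (K : fieldType) (n : nat).
Implicit Types (X Z : set 'rV[K]_n).

Definition proj_zeros (S : set {mpoly K[n]}) : set 'rV[K]_n :=
  [set x : 'rV[K]_n | x != 0 /\ forall p, S p -> p.@[fun i => x 0 i] = 0].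

Definition proj_closed X : Prop :=
  exists S : set {mpoly K[n]},
    (forall p, S p -> exists d : nat, p \is d.-homog) /\ X = proj_zeros S.

Definition proj_irreducible X : Prop :=
  [/\ proj_closed X,
      X !=set0
    & forall X1 X2, proj_closed X1 -> proj_closed X2 ->
        X `<=` X1 `|` X2 -> X `<=` X1 \/ X `<=` X2].

(* X contains a strictly increasing chain of k irreducible closed subsets. *)
Definition proj_chain X (k : nat) : Prop :=
  exists Z : 'I_k -> set 'rV[K]_n,
    (forall i, proj_irreducible (Z i) /\ Z i `<=` X) /\
    (forall i j : 'I_k, (i < j)%N -> Z i `<` Z j).

(* Krull dimension: a chain Z_0 < ... < Z_d has d + 1 members, and the empty
   set, which contains only the chain with no member, gets dimension -1.
   Chains in P(K^n), a space of dimension n - 1, have at most n members, so the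
   bound on k only serves to make the maximum a finite one. *)
Definition proj_dim X : int :=
  (\max_(k < n.+1 | `[< proj_chain X k >]) k)%N%:Z - 1.

(* Codimension (n - 1) - dim X; it is nonnegative because proj_dim X <= n - 1,
   so absz is just the conversion from int to nat. *)
Definition proj_codim X : nat := absz ((n%:Z - 1) - proj_dim X)%R.

End ProjectiveDimension.

(* Elements of K^a (x) K^b (x) K^c, given by their coordinates. *)
Definition tensor (K : fieldType) (a b c : nat) : Type :=
  {ffun 'I_a * 'I_b * 'I_c -> K}.

Section Tensor.
Variables (K : fieldType) (a b c : nat).
Implicit Type T : tensor K a b c.

Definition flatA T (x : 'rV[K]_a) : 'M[K]_(b, c) :=
  \matrix_(j, k) \sum_i x 0 i * T (i, j, k).
Definition flatB T (y : 'rV[K]_b) : 'M[K]_(a, c) :=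
  \matrix_(i, k) \sum_j y 0 j * T (i, j, k).
Definition flatC T (z : 'rV[K]_c) : 'M[K]_(a, b) :=
  \matrix_(i, j) \sum_k z 0 k * T (i, j, k).

Definition concise T : Prop :=
  [/\ injective (flatA T), injective (flatB T) & injective (flatC T)].

Definition rank_locus T (r : nat) : set 'rV[K]_a :=
  [set x : 'rV[K]_a | x != 0 /\ (\rank (flatA T x) <= r)%N].

Definition codim_plus_rank T (r : nat) : nat :=
  (proj_codim (rank_locus T r) + r)%N.

Lemma codim_plus_rank_attained T :
  exists g, `[< exists r, codim_plus_rank T r = g >].
Proof. by exists (codim_plus_rank T 0); apply/asboolP; exists 0%N. Qed.

Definition geometric_rank T : nat := ex_minn (codim_plus_rank_attained T).

Definition achieves_GR T (r : nat) : Prop :=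
  geometric_rank T = codim_plus_rank T r.

Definition degenerate_GR T : Prop :=
  (geometric_rank T < minn a (minn b c))%N.

End Tensor.

(* Affine cone over the Segre variety, without its vertex. *)
Definition segre (K : fieldType) (b c : nat) : set 'M[K]_(b, c) :=
  [set M | \rank M = 1%N].

(* Main.v *)
Require Import Defs.
From HB Require Import structures.
From mathcomp Require Import all_boot all_order all_algebra.
From mathcomp Require Import boolp classical_sets reals.
From mathcomp Require Import complex mpoly.

Set Implicit Arguments.
Unset Strict Implicit.
Unset Printing Implicit Defensive.

Import Order.TTheory GRing.Theory Num.Theory.

Local Open Scope ring_scope.

(** Let [k] be the largest length of a chain of irreducible closed subsets of
    the rank one locus [Y1], and [k2] the same number for the rank two locus
    [Y2].  A chain in P(K^m) has at most [m] members ([proj_chain_le]), so the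
    codimensions are [m - k] and [m - k2].  Since [r = 1] achieves the geometric
    rank and [r = 2] does not, [m - k + 1 < m - k2 + 2], that is [k2 <= k]:
    passing from [Y1] to [Y2] does not raise the dimension.  Degeneracy gives
    [m - k + 1 < m], hence [2 <= k].

    Let [X] be the top of a chain of length [k] in [Y1] and [x] a point of its
    lowest member.  The join of [x] and [X], i.e. the closure of the union of
    the lines from [x] to points of [X], is irreducible and contains [X]; it
    lies in [Y2], because the rank of [T_A] is subadditive and rank loci are
    closed ([rank_locus_closed]).  If it were larger than [X] it would extend
    the chain to one of length [k + 1] in [Y2].  So the join is [X], and [X]
    contains the line through [x] and any other point [y]; such a [y] exists
    because [k >= 2].  [T_A] is injective and maps this line to a line of
    matrices of rank one ([segre_pencil_of_chains]).

    Irreducibility of the join is checked on points: an irreducible projective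
    set is irreducible for polynomials that need not be homogeneous
    ([proj_irreducible_aff]), a property that passes to [x]-translates and then
    to closures.  The bound on the length of chains comes from counting
    functions: each step of a chain raises by one the exponent with which the
    number of independent polynomial functions of bounded degree grows, and in
    [n] variables that exponent is at most [n]. *)

(** * Irreducibility and closures tested on points *)

Definition pt_eval (K : fieldType) n (f : {mpoly K[n]}) (x : 'rV[K]_n) : K :=
  f.@[fun i => x 0 i].

(** Irreducibility of the Zariski closure in affine space, expressed on the
    points of [P]; unlike [proj_irreducible] it allows all polynomials, which is
    what survives a substitution such as [y |-> a + y]. *)
Definition aff_irreducible (K : fieldType) n (P : set 'rV[K]_n) : Prop :=
  forall f g : {mpoly K[n]},
    (exists2 x, P x & pt_eval f x != 0) -> (exists2 x, P x & pt_eval g x != 0) ->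
  exists2 x, P x & (pt_eval f x != 0) && (pt_eval g x != 0).

Definition with_origin (K : fieldType) n (X : set 'rV[K]_n) : set 'rV[K]_n :=
  [set x | x = 0 \/ X x].

(** When [X] is stable under nonzero scalars this is the cone over the join of
    [a] and [X], except possibly for the line of [a] itself. *)
Definition translates (K : fieldType) n (a : 'rV[K]_n) (X : set 'rV[K]_n)
  : set 'rV[K]_n := [set s *: a + y | s in setT & y in X].

(** The Zariski closure, in projective space, of the nonzero points of [P]. *)
Definition hclosure (K : fieldType) n (P : set 'rV[K]_n) : set 'rV[K]_n :=
  proj_zeros [set f | (exists d : nat, f \is d.-homog) /\
                      forall x, P x -> pt_eval f x = 0].

Section Eval.
Variables (K : fieldType) (n : nat).
Implicit Types (f g : {mpoly K[n]}) (x y a : 'rV[K]_n) (s t : K).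

Lemma pt_evalM f g x : pt_eval (f * g) x = pt_eval f x * pt_eval g x.
Proof. exact: mevalM. Qed.

Lemma pt_evalXU i x : pt_eval 'X_i x = x 0 i.
Proof. exact: mevalXU. Qed.

Lemma pt_eval_line f a y :
  exists q : {poly K}, forall s, q.[s] = pt_eval f (s *: a + y).
Proof.
exists (mmap polyC (fun i => (a 0 i)%:P * 'X + (y 0 i)%:P) f) => s.
rewrite /mmap /pt_eval mevalE horner_sum; apply: eq_bigr => m _.
rewrite hornerM hornerC; congr (_ * _); rewrite /mmap1 horner_prod.
by apply: eq_bigr => i _; rewrite horner_exp !hornerE !mxE mulrC.
Qed.

Lemma pt_eval_shift f a :
  exists g, forall y, pt_eval g y = pt_eval f (a + y).
Proof.
exists (f \mPo [tuple (a 0 i)%:MP + 'X_i | i < n]) => y.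
rewrite /pt_eval comp_mpoly_meval; apply: meval_eq => i.
by rewrite tnth_mktuple mevalD mevalC mevalXU mxE.
Qed.

Lemma pt_eval_homog d f t x :
  f \is d.-homog -> pt_eval f (t *: x) = t ^+ d * pt_eval f x.
Proof.
move=> /dhomogP fd; rewrite /pt_eval !mevalE mulr_sumr big_seq [RHS]big_seq.
apply: eq_bigr => m /fd md; rewrite mulrCA; congr (_ * _).
rewrite -md /= mdegE -prodrXr -big_split /=.
by apply: eq_bigr => i _; rewrite mxE exprMn.
Qed.

(** Along the line of [x], the coefficients of [f] are the values at [x] of its
    homogeneous components: this is how statements on homogeneous polynomials
    are carried over to all polynomials. *)
Lemma pt_eval_scale f x :
  pt_eval f x = \sum_(d < mmeasure mdeg f) pt_eval (pihomog mdeg d f) x /\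
  forall t, pt_eval f (t *: x) =
    (\poly_(d < mmeasure mdeg f) pt_eval (pihomog mdeg d f) x).[t].
Proof.
have E z : pt_eval f z = \sum_(d < mmeasure mdeg f) pt_eval (pihomog mdeg d f) z.
  by rewrite {1}(pihomog_partitionE (leqnn (mmeasure mdeg f))) /pt_eval raddf_sum.
split=> // t; rewrite E horner_poly; apply: eq_bigr => d _.
by rewrite (pt_eval_homog t x (pihomogP mdeg d f)) mulrC.
Qed.

Lemma pt_eval_component f x : pt_eval f x != 0 ->
  exists d, pt_eval (pihomog mdeg d f) x != 0.
Proof.
have [-> _] := pt_eval_scale f x; apply: contraNP => H.
apply/eqP; apply: big1 => d _; apply/eqP; apply: contrapT => /negP h.
by apply: H; exists d.
Qed.

Lemma dhomog_prod_ord l (F : 'I_l -> {mpoly K[n]}) :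
  (forall i, F i \is 1.-homog) -> \prod_i F i \is l.-homog.
Proof.
elim: l F => [|l IH] F F1; first by rewrite big_ord0 dhomog1.
rewrite big_ord_recl; apply: (dhomogM (F1 ord0)); exact: IH.
Qed.

End Eval.

Section Closed.
Variables (K : fieldType) (n : nat).
Implicit Types (f g : {mpoly K[n]}) (x y z : 'rV[K]_n) (t : K).
Implicit Types (X P : set 'rV[K]_n).

Lemma proj_closed_scale X x t : proj_closed X -> t != 0 -> X x -> X (t *: x).
Proof.
case=> S [Sh ->] t0 [x0 xS].
split; first by rewrite scaler_eq0 negb_or t0.
move=> p Sp; have [d pd] := Sh p Sp.
by have := pt_eval_homog t x pd; rewrite /pt_eval (xS p Sp) mulr0.
Qed.

Lemma proj_closed_zeros1 f d : f \is d.-homog ->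
  proj_closed (proj_zeros [set f]).
Proof. by move=> fd; exists [set f]%classic; split=> // p ->; exists d. Qed.

Lemma hclosure_closed P : proj_closed (hclosure P).
Proof. by eexists; split; last reflexivity; move=> p []. Qed.

Lemma sub_hclosure P x : P x -> x != 0 -> hclosure P x.
Proof. by move=> Px x0; split=> // p [_ /(_ x Px)]. Qed.

Lemma nonzero_coord x : x != 0 -> exists i, x 0 i != 0.
Proof.
move=> x0; apply/existsP; rewrite -negb_forall; apply: contra x0 => /forallP h.
by apply/eqP/rowP => i; rewrite mxE; apply/eqP.
Qed.

(** An equation of [X] that fails at [x] is multiplied by a coordinate that is
    nonzero at [x], so that it also vanishes at the origin, even if the equation
    was a constant. *)
Lemma proj_closed_separate X x : proj_closed X -> x != 0 -> ~ X x ->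
  exists f, [/\ exists d : nat, f \is d.-homog, pt_eval f x != 0 &
                forall y, with_origin X y -> pt_eval f y = 0].
Proof.
move=> [S [Sh ->]] x0 nXx; have [i xi] := nonzero_coord x0.
have [p Sp px] : exists2 p, S p & pt_eval p x != 0.
  apply: contrapT => H; apply: nXx; split=> // p Sp.
  by apply/eqP; apply: contrapT => /negP px; apply: H; exists p.
exists (p * 'X_i); rewrite pt_evalM pt_evalXU mulf_neq0 //; split=> //.
  have [d pd] := Sh p Sp; exists (d + 1)%N.
  by apply: dhomogM; rewrite ?dhomogX /= ?mdeg1.
move=> y; rewrite pt_evalM pt_evalXU => -[->|[_ /(_ p Sp) py]].
  by rewrite mxE mulr0.
by rewrite /pt_eval py mul0r.
Qed.

Lemma hclosure_min P X : proj_closed X -> (P `<=` with_origin X)%classic ->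
  (hclosure P `<=` X)%classic.
Proof.
move=> Xcl PX w [w0 wP]; apply: contrapT => nXw.
have [f [fh fw fX]] := proj_closed_separate Xcl w0 nXw.
by move/eqP: fw; apply; apply: wP; split=> // x /PX /fX.
Qed.

(** Two closed sets that do not contain the closure are separated from points
    of [P] by polynomials vanishing at the origin; a point of [P] where both
    are nonzero is then a nonzero vector outside both closed sets. *)
Lemma hclosure_irreducible P x : aff_irreducible P -> P x -> x != 0 ->
  proj_irreducible (hclosure P).
Proof.
move=> Pirr Px x0; split; [exact: hclosure_closed|by exists x; apply: sub_hclosure|].
move=> X1 X2 X1cl X2cl PX.
have sep X : proj_closed X -> ~ (hclosure P `<=` X)%classic ->
    exists2 f, exists2 z, P z & pt_eval f z != 0 &
      forall z, with_origin X z -> pt_eval f z = 0.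
  move=> Xcl nX; have [z Pz nz] : exists2 z, P z & ~ with_origin X z.
    apply: contrapT => H; apply: nX; apply: hclosure_min => // z Pz.
    by apply: contrapT => nz; apply: H; exists z.
  have [|| f [_ fz fX]] := proj_closed_separate (x := z) Xcl.
  - by apply/eqP => z0; apply: nz; left.
  - by move=> Xz; apply: nz; right.
  by exists f => //; exists z.
apply: contrapT => /not_orP [/(sep _ X1cl) [f fP f1] /(sep _ X2cl) [g gP g2]].
have [z Pz /andP [fz gz]] := Pirr _ _ fP gP.
have z0 : z != 0 by apply: contraNneq fz => ->; rewrite f1 //; left.
have [Xz|Xz] := PX z (sub_hclosure Pz z0).
  by move: fz; rewrite f1 ?eqxx //; right.
by move: gz; rewrite g2 ?eqxx //; right.
Qed.

End Closed.

Section Irr.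
Variables (K : closedFieldType) (n : nat).
Implicit Types (f g : {mpoly K[n]}) (x y a : 'rV[K]_n) (s t : K).
Implicit Types (X P : set 'rV[K]_n).

(** The product ['X * p * q] is nonzero, and a closed field is infinite. *)
Lemma common_nonroot (p q : {poly K}) (a b : K) : p.[a] != 0 -> q.[b] != 0 ->
  exists2 t, t != 0 & (p.[t] != 0) && (q.[t] != 0).
Proof.
move=> pa qb.
have nz (r : {poly K}) (c : K) : r.[c] != 0 -> r != 0.
  by apply: contraNneq => ->; rewrite horner0.
have : 'X * (p * q) != 0.
  by rewrite !mulf_neq0 ?polyX_eq0 ?(nz _ _ pa) ?(nz _ _ qb).
case/closed_nonrootP=> t; rewrite /root !hornerE !mulf_eq0 !negb_or.
by rewrite -andbA => /andP [t0 pq]; exists t.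
Qed.

(** A component of [f] and one of [g] are both nonzero at some [y] of [X];
    then [f] and [g] are nonzero polynomials on the line of [y], and [X]
    contains the nonzero points of that line. *)
Lemma proj_irreducible_aff X : proj_irreducible X -> aff_irreducible X.
Proof.
move=> [Xcl _ Xirr] f g [x1 X1 f1] [x2 X2 g2].
have [d fd] := pt_eval_component f1; have [e ge] := pt_eval_component g2.
have hd := pihomogP mdeg d f; have he := pihomogP mdeg e g.
have [y Xy [fy gy]] : exists2 y, X y &
    pt_eval (pihomog mdeg d f) y != 0 /\ pt_eval (pihomog mdeg e g) y != 0.
  apply: contrapT => H.
  have nz y : X y -> y != 0 by case: Xcl => S [_ ->] [].
  case: (Xirr _ _ (proj_closed_zeros1 hd) (proj_closed_zeros1 he)).
  - move=> y Xy; have [f0|f0] := eqVneq (pt_eval (pihomog mdeg d f) y) 0.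
      by left; split; [exact: nz | move=> p ->].
    have [g0|g0] := eqVneq (pt_eval (pihomog mdeg e g) y) 0.
      by right; split; [exact: nz | move=> p ->].
    by case: H; exists y.
  - by move=> /(_ _ X1) [_ /(_ _ erefl)] /eqP; apply/negP.
  - by move=> /(_ _ X2) [_ /(_ _ erefl)] /eqP; apply/negP.
have ray h c : pt_eval (pihomog mdeg c h) y != 0 ->
    exists u, pt_eval h (u *: y) != 0.
  move=> hc; have [_ E] := pt_eval_scale h y.
  have /closed_nonrootP [u] :
      \poly_(i < mmeasure mdeg h) pt_eval (pihomog mdeg i h) y != 0.
    apply: contraNneq hc => /polyP /(_ c).
    rewrite coef_poly coef0; case: ltnP => [_ -> //|le _].
    rewrite pihomogE big_seq_cond big_pred0 ?/pt_eval ?meval0 // => m.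
    apply/negP => /andP [/(@mmeasure_mnm_lt _ _ mdeg) mh /eqP mc].
    by have := leq_trans mh le; rewrite mc ltnn.
  by rewrite /root -E; exists u.
have [u fu] := ray _ _ fy; have [v gv] := ray _ _ gy.
have [_ Ef] := pt_eval_scale f y; have [_ Eg] := pt_eval_scale g y.
move: fu gv; rewrite Ef Eg => fu gv.
have [t t0] := common_nonroot fu gv; rewrite -Ef -Eg => ftg.
by exists (t *: y) => //; apply: proj_closed_scale.
Qed.

Lemma aff_irreducible_with_origin X :
  proj_irreducible X -> aff_irreducible (with_origin X).
Proof.
move=> Xi; have [Xcl [w Xw] _] := Xi.
have mv f : (exists2 x, with_origin X x & pt_eval f x != 0) ->
    exists2 x, X x & pt_eval f x != 0.
  case=> x [->|Xx] fx; last by exists x.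
  have [_ E] := pt_eval_scale f w.
  move: fx; rewrite -(scale0r w) E => fx.
  have [t t0] := common_nonroot fx fx; rewrite -E => /andP [ft _].
  by exists (t *: w) => //; apply: proj_closed_scale.
move=> f g /mv fX /mv gX; have [x Xx fgx] := proj_irreducible_aff Xi fX gX.
by exists x => //; right.
Qed.

(** First a common [y] is found for the two values [s1], [s2] of the scalar,
    then a common scalar on the line of direction [a] through [y]. *)
Lemma aff_irreducible_translates a P :
  aff_irreducible P -> aff_irreducible (translates a P).
Proof.
move=> Pirr f g [_ [s1 _ [y1 P1 <-]] f1] [_ [s2 _ [y2 P2 <-]] g2].
have [f' Ef] := pt_eval_shift f (s1 *: a).
have [g' Eg] := pt_eval_shift g (s2 *: a).
have [||y Py] := Pirr f' g'; first by exists y1; rewrite ?Ef.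
  by exists y2; rewrite ?Eg.
rewrite Ef Eg => /andP [].
have [p Ep] := pt_eval_line f a y; have [q Eq] := pt_eval_line g a y.
rewrite -Ep -Eq => fy gy; have [t _] := common_nonroot fy gy.
by rewrite Ep Eq => fg; exists (t *: a + y) => //; exists t => //; exists y.
Qed.

End Irr.

(** * The length of chains *)

(** At least [t ^ k] polynomials of degree [O(t)] are linearly independent as
    functions on [P]: a lower bound on the Hilbert function of [P], which amounts
    to the closure of [P] in affine space having dimension at least [k]. *)
Definition poly_growth (K : fieldType) n (P : set 'rV[K]_n) (k : nat) : Prop :=
  exists e : nat, forall t : nat,
  exists (I : finType) (g : I -> {mpoly K[n]}),
    [/\ #|I| = (t ^ k)%N,
        forall i, (msize (g i) <= (e * t).+1)%N
      & forall c : I -> K,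
          (forall x, P x -> \sum_i c i * pt_eval (g i) x = 0) ->
          forall i, c i = 0].

Section Growth.
Variables (K : fieldType) (n : nat).
Implicit Types (f g : {mpoly K[n]}) (x : 'rV[K]_n) (P Q : set 'rV[K]_n).

Lemma msizeM_bound f g d e : (msize f <= d.+1)%N -> (msize g <= e.+1)%N ->
  (msize (f * g) <= (d + e).+1)%N.
Proof.
have [->|f0] := eqVneq f 0; first by rewrite mul0r msize0.
have [->|g0] := eqVneq g 0; first by rewrite mulr0 msize0.
rewrite msizeM // => fd ge; have := leq_add fd ge.
by case: (msize f + msize g)%N => // s; rewrite addSn addnS /= ltnS.
Qed.

Lemma msizeX_bound f d i :
  (msize f <= d.+1)%N -> (msize (f ^+ i) <= (d * i).+1)%N.
Proof.
move=> fd; elim: i => [|i IH]; first by rewrite expr0 msize1.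
by rewrite exprS mulnS; apply: msizeM_bound.
Qed.

Lemma poly_growth_origin : poly_growth [set (0 : 'rV[K]_n)]%classic 0.
Proof.
exists 0%N => t; exists unit, (fun=> 1); split; first by rewrite card_unit.
  by move=> i; rewrite msize1.
move=> c /(_ 0 erefl); rewrite /pt_eval meval1.
by rewrite (big_pred1 tt) => [|[]//]; rewrite mulr1 => c0 [].
Qed.

(** The products [f ^+ i * g j] with [i < t] are independent on [Q] if the [g j]
    are independent on [P].  On [P], where [f] vanishes, a vanishing combination
    reduces to its terms with [i = 0], so their coefficients are zero; what remains
    is [f] times a shorter combination, and on the irreducible [Q] the factor
    [f], not being identically zero, can be cancelled. *)
Lemma poly_growth_step P Q f k :
  (P `<=` Q)%classic -> aff_irreducible Q -> (forall x, P x -> pt_eval f x = 0) ->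
  (exists2 x, Q x & pt_eval f x != 0) -> poly_growth P k -> poly_growth Q k.+1.
Proof.
move=> PQ Qirr fP fQ [e He]; exists (msize f + e)%N => t.
have [I [g [cardI gsize gfree]]] := He t.
exists ('I_t * I)%type, (fun i : 'I_t * I => f ^+ i.1 * g i.2); split.
- by rewrite card_prod card_ord cardI expnS.
- move=> [i j] /=; rewrite mulnDl.
  apply: leq_trans (msizeM_bound (msizeX_bound i (leqnSn _)) (gsize j)) _.
  by rewrite ltnS leq_add2r leq_mul2l ltnW ?orbT.
have key s (c : nat -> I -> K) :
    (forall x, Q x -> \sum_(i < s) pt_eval f x ^+ i *
        (\sum_j c i j * pt_eval (g j) x) = 0) ->
    forall i j, (i < s)%N -> c i j = 0.
  elim: s c => [//|s IH] c Hc.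
  have c0 j : c 0%N j = 0.
    apply: (gfree (c 0%N)) => x Px; have := Hc x (PQ x Px).
    rewrite big_ord_recl expr0 mul1r [X in _ + X]big1 ?addr0 // => i _.
    by rewrite (fP x Px) exprS !mul0r.
  case=> [//|i] j; rewrite ltnS; apply: (IH (fun i => c i.+1)) => {i j} x Qx.
  (* The combination that remains after dividing by one factor f. *)
  pose h := \sum_(i < s) f ^+ i * (\sum_j c i.+1 j *: g j).
  have Eh y : pt_eval h y =
      \sum_(i < s) pt_eval f y ^+ i * (\sum_j c i.+1 j * pt_eval (g j) y).
    rewrite /h /pt_eval rmorph_sum; apply: eq_bigr => i _.
    rewrite rmorphM rmorphXn rmorph_sum /=; congr (_ * _).
    by apply: eq_bigr => j _; rewrite mevalZ.
  rewrite -Eh; apply/eqP; apply: contrapT => /negP hx.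
  have [|y Qy /andP [fy hy]] := Qirr f h fQ; first by exists x.
  have := Hc y Qy; rewrite big_ord_recl expr0 mul1r big1; last first.
    by move=> j _; rewrite c0 mul0r.
  rewrite add0r => /eqP; apply/negP.
  rewrite (eq_bigr (fun i : 'I_s => pt_eval f y * (pt_eval f y ^+ i *
    (\sum_j c i.+1 j * pt_eval (g j) y)))) => [|i _].
    by rewrite -mulr_sumr -Eh mulf_neq0.
  by rewrite exprS mulrA.
move=> c Hc [i j].
(* The coefficients, extended by zero to all natural i as key requires. *)
pose c' i j := if insub i is Some i' then c (i', j) else 0.
have cE (i' : 'I_t) j' : c' i' j' = c (i', j') by rewrite /c' valK.
rewrite -cE; apply: (key t) => // x Qx; rewrite -[RHS](Hc x Qx).
rewrite (eq_bigr (fun i : 'I_t => \sum_j c (i, j) *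
  pt_eval (f ^+ i * g j) x)) => [|i' _]; last first.
  rewrite mulr_sumr; apply: eq_bigr => j' _.
  by rewrite cE mulrCA pt_evalM /pt_eval rmorphXn.
by rewrite pair_bigA; apply: eq_bigr => -[].
Qed.

(** Polynomials of degree at most [d] are determined by their coefficients on the
    monomials with all exponents at most [d]. *)
Lemma card_independent_le (I : finType) (g : I -> {mpoly K[n]}) d P :
  (forall i, msize (g i) <= d.+1)%N ->
  (forall c : I -> K, (forall x, P x -> \sum_i c i * pt_eval (g i) x = 0) ->
     forall i, c i = 0) ->
  (#|I| <= d.+1 ^ n)%N.
Proof.
move=> gsize gfree; pose N := {ffun 'I_n -> 'I_d.+1}.
have cN : #|N| = (d.+1 ^ n)%N by rewrite card_ffun !card_ord.
pose mon (a : N) : 'X_{1..n} := [multinom (a i : nat) | i < n].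
pose A := \matrix_(i < #|I|, j < #|N|) (g (enum_val i))@_(mon (enum_val j)).
rewrite -cN leqNgt; apply/negP => lt.
have /rowV0Pn [v /sub_kermxP vA /negP []] : kermx A != 0.
  rewrite -mxrank_eq0 mxrank_ker subn_eq0 -ltnNge.
  exact: leq_ltn_trans (rank_leq_col A) lt.
have g0 : \sum_i v 0 (enum_rank i) *: g i = 0.
  apply/mpolyP => a; rewrite mcoeff0 raddf_sum /=.
  have [lad|dla] := leqP (mdeg a) d; last first.
    apply: big1 => i _; rewrite mcoeffZ memN_msupp_eq0 ?mulr0 //.
    by apply: msize_mdeg_ge; apply: leq_trans (gsize i) dla.
  have ad i : (a i < d.+1)%N.
    by rewrite ltnS; apply: leq_trans lad; rewrite mdegE (bigD1 i) //= leq_addr.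
  pose b : N := [ffun i => Ordinal (ad i)].
  have ab : a = mon b by apply/mnmP => i; rewrite mnmE ffunE.
  have := congr1 (fun M : 'rV_#|N| => M 0 (enum_rank b)) vA.
  rewrite !mxE => vb; rewrite -[RHS]vb.
  rewrite [LHS](reindex_onto enum_val enum_rank) /=; first last.
    by move=> i _; rewrite enum_rankK.
  rewrite (eq_bigl xpredT) => [|i]; last by rewrite enum_valK eqxx.
  by apply: eq_bigr => i _; rewrite mcoeffZ mxE enum_valK enum_rankK ab.
apply/eqP/rowP => i; rewrite mxE -(enum_valK i).
apply: (gfree (fun i => v 0 (enum_rank i))) => x _.
have := congr1 (fun h => pt_eval h x) g0; rewrite /pt_eval meval0 => gx.
by rewrite -[RHS]gx raddf_sum /=; apply: eq_bigr => j _; rewrite mevalZ.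
Qed.

(** Otherwise [t ^ n.+1 <= (e * t + 1) ^ n <= (e + 1) ^ n * t ^ n] for all
    [t > 0], which fails for [t > (e + 1) ^ n]. *)
Lemma poly_growth_le P k : poly_growth P k -> (k <= n)%N.
Proof.
case=> e He; rewrite leqNgt; apply/negP => nk.
pose t := (e.+1 ^ n).+1; have [I [g [cI gsize gfree]]] := He t.
have := card_independent_le gsize gfree; rewrite cI leqNgt => /negP; apply.
apply: (@leq_trans (t ^ n.+1)); last by rewrite leq_exp2l // /t ltnS expn_gt0.
apply: (@leq_ltn_trans ((e.+1 * t) ^ n)).
  by case: (n) => // n'; rewrite leq_exp2r // mulSn addnC -addn1 leq_add2l.
by rewrite expnMn expnS ltn_pmul2r ?expn_gt0.
Qed.

End Growth.

Section Chains.
Variables (K : closedFieldType) (n : nat).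
Implicit Types (X Y W : set 'rV[K]_n).

(** The origin, put below the chain, provides one more member: with [k] members
    the growth exponent at the top is [k] and not only [k - 1]. *)
Lemma proj_chain_le X k : proj_chain X k -> (k <= n)%N.
Proof.
case: k => // k [Z [Zirr Zlt]].
suff H i (ik : (i < k.+1)%N) : poly_growth (with_origin (Z (Ordinal ik))) i.+1.
  by apply: (@poly_growth_le K n _ _ (H k (ltnSn k))).
elim: i ik => [|i IH] ik; have [ZI _] := Zirr (Ordinal ik);
    have [[S [_ ZS]] _ _] := ZI.
  have [_ [x Zx] _] := ZI; have x0 : x != 0 by move: Zx; rewrite ZS => -[].
  have [j xj] := nonzero_coord x0.
  apply: (poly_growth_step (f := 'X_j) _ _ _ _ (poly_growth_origin K n)).
  - by move=> y ->; left.
  - exact: aff_irreducible_with_origin.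
  - by move=> y ->; rewrite pt_evalXU mxE.
  - by exists x; [right | rewrite pt_evalXU].
have ik' : (i < k.+1)%N by exact: ltnW.
have [sub nsub] : (Z (Ordinal ik') `<` Z (Ordinal ik))%classic by exact: Zlt.
have [x Zx nZx] : exists2 x, Z (Ordinal ik) x & ~ Z (Ordinal ik') x.
  apply: contrapT => H; apply: nsub => x Zx.
  by apply: contrapT => nZx; apply: H; exists x.
have [[Zcl _ _] _] := Zirr (Ordinal ik').
have x0 : x != 0 by move: Zx; rewrite ZS => -[].
have [f [_ fx f0]] := proj_closed_separate Zcl x0 nZx.
apply: (poly_growth_step (f := f) _ _ f0 _ (IH ik')).
- by move=> y [->|Zy]; [left | right; apply: sub].
- exact: aff_irreducible_with_origin.
- by exists x => //; right.
Qed.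

Lemma proj_codim_chain X :
  exists k, [/\ proj_chain X k, proj_codim X = (n - k)%N
              & forall j, proj_chain X j -> (j <= k)%N].
Proof.
pose P (k : 'I_n.+1) := `[< proj_chain X k >].
have P0 : P ord0 by apply/asboolP; exists (fun i => X); split=> -[].
have [|i Pi mi] := @eq_bigmax_cond _ P (fun k => k : nat).
  by apply/card_gt0P; exists ord0.
exists i; split; first exact/asboolP.
  rewrite /proj_codim /proj_dim -/P mi.
  by rewrite opprB addrA subrK subzn // -ltnS.
move=> j Xj; rewrite -mi; have jn := proj_chain_le Xj.
apply: (@leq_bigmax_cond _ P (fun k => k : nat) (Ordinal (jn : (j < n.+1)%N))).
exact/asboolP.
Qed.

Lemma proj_chain_rcons X Y W k (Z : 'I_k.+1 -> set 'rV[K]_n) :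
  (forall i, proj_irreducible (Z i) /\ (Z i `<=` X)%classic) ->
  (forall i j : 'I_k.+1, (i < j)%N -> (Z i `<` Z j)%classic) ->
  (X `<=` Y)%classic -> proj_irreducible W -> (W `<=` Y)%classic ->
  (Z ord_max `<` W)%classic -> proj_chain Y k.+2.
Proof.
move=> Zirr Zlt XY Wirr WY ZW.
exists (fun i => if unlift ord_max i is Some j then Z j else W); split.
  move=> i; case: unliftP => [j|] _; last by [].
  by have [Zi ZX] := Zirr j; split=> // x /ZX /XY.
move=> i j; case: unliftP => [i' ->|->]; case: unliftP => [j' ->|->].
- by rewrite !lift_max; apply: Zlt.
- move=> _; have [->//|ne] := eqVneq i' ord_max.
  have [sub _] : (Z i' `<` Z ord_max)%classic.
    by apply: Zlt; rewrite ltn_neqAle ne /= -ltnS.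
  have [ZsW WnZ] := ZW; split=> [x /sub /ZsW //|WZ]; apply: WnZ => x /WZ.
  exact: sub.
- by rewrite lift_max /= ltnNge ltnW ?ltn_ord.
- by rewrite ltnn.
Qed.

End Chains.

(** * Rank loci *)

Section RankLoci.
Variables (K : fieldType) (a b c : nat) (T : tensor K a b c).

Lemma flatA_is_linear : linear (flatA T).
Proof.
move=> s x y; apply/matrixP => j k; rewrite !mxE mulr_sumr -big_split /=.
by apply: eq_bigr => i _; rewrite !mxE mulrDl mulrA.
Qed.

HB.instance Definition _ :=
  GRing.isLinear.Build K 'rV[K]_a 'M[K]_(b, c) _ (flatA T) flatA_is_linear.

(** Determinants of all compressions of [M] play the role of minors: the base
    changes that reduce [M] to a partial identity matrix provide [U] and [V] for
    which the product is the identity. *)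
Lemma mxrank_gtP r (M : 'M[K]_(b, c)) :
  reflect (exists U V, \det (U *m M *m V : 'M[K]_r.+1) != 0) (r < \rank M)%N.
Proof.
apply: (iffP idP) => [rM | [U [V]]].
  exists (pid_mx r.+1 *m invmx (col_ebase M)).
  exists (invmx (row_ebase M) *m pid_mx r.+1).
  rewrite -{2}(mulmx_ebase M) !mulmxA mulmxKV ?col_ebase_unit //.
  rewrite mulmxK ?row_ebase_unit // !mul_pid_mx.
  have rb := leq_trans rM (rank_leq_row M); have rc := leq_trans rM (rank_leq_col M).
  rewrite (minn_idPl rM) (minn_idPr rb) minnn (minn_idPr rc) pid_mx_1 det1.
  exact: oner_neq0.
rewrite -unitfE -unitmxE => /mxrank_unit <-.
exact: leq_trans (mxrankM_maxl _ _) (mxrankM_maxr _ _).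
Qed.

Definition generic_flatA : 'M[{mpoly K[a]}]_(b, c) :=
  \matrix_(j, k) \sum_i T (i, j, k) *: 'X_i.

Lemma rank_locus_closed r : proj_closed (rank_locus T r).
Proof.
pose p (U : 'M[K]_(r.+1, b)) (V : 'M[K]_(c, r.+1)) :=
  \det (map_mx (@mpolyC a K) U *m generic_flatA *m map_mx (@mpolyC a K) V).
have pE U V x : pt_eval (p U V) x = \det (U *m flatA T x *m V).
  rewrite /pt_eval -det_map_mx !map_mxM -!map_mx_comp.
  have mapC m n (A : 'M[K]_(m, n)) :
      map_mx (meval (fun i => x 0 i) \o @mpolyC a K) A = A.
    by apply/matrixP => i j; rewrite !mxE /= mevalC.
  rewrite !mapC; congr (\det (_ *m _ *m _)); apply/matrixP => j k.
  rewrite !mxE rmorph_sum; apply: eq_bigr => i _ /=.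
  by rewrite mevalZ mevalXU mulrC.
have ph U V : p U V \is (r.+1).-homog.
  apply: rpred_sum => s _; rewrite rpredMsign; apply: dhomog_prod_ord => i.
  rewrite mxE; apply: rpred_sum => k _; rewrite !mxE mulrC mul_mpolyC rpredZ //.
  apply: rpred_sum => j _; rewrite !mxE mul_mpolyC rpredZ // rpred_sum // => l _.
  by rewrite rpredZ // dhomogX /= mdeg1.
exists [set q | exists U V, q = p U V]%classic; split.
  by move=> q [U [V ->]]; exists r.+1.
apply/seteqP; split=> x [x0 xr]; split=> //.
  move=> q [U [V ->]]; rewrite -[LHS]/(pt_eval _ _) pE.
  apply/eqP; apply: contraTT xr => d0; rewrite -ltnNge.
  by apply/mxrank_gtP; exists U, V.
rewrite leqNgt; apply/negP => /mxrank_gtP [U [V]]; rewrite -pE.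
by rewrite /pt_eval xr ?eqxx //; exists U, V.
Qed.

(** By linearity of [T_A], a multiple of [x] changes the rank of a matrix of the
    family by at most [r]. *)
Lemma translates_rank_locus r r' x X :
  rank_locus T r x -> (X `<=` rank_locus T r')%classic ->
  (translates x X `<=` with_origin (rank_locus T (r + r')))%classic.
Proof.
move=> [_ xr] Xr _ [s _ [y /Xr [_ yr] <-]].
have [->|z0] := eqVneq (s *: x + y) 0; [by left | right; split=> //].
rewrite linearP; apply: leq_trans (mxrank_add _ _) (leq_add _ yr).
exact: leq_trans (mxrankS (scalemx_sub s (submx_refl _))) xr.
Qed.

Lemma segre_pencil x y :
  injective (flatA T) -> y != 0 -> (forall s, x != s *: y) ->
  (forall s t, s *: x + t *: y != 0 -> rank_locus T 1 (s *: x + t *: y)) ->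
  exists L : {vspace 'M[K]_(b, c)},
    [/\ (1 < \dim L)%N,
        forall M, M \in L -> exists alpha, flatA T alpha = M
      & forall M, M \in L -> M != 0 -> segre M].
Proof.
move=> Tinj y0 xy line; pose L := << [:: flatA T x; flatA T y] >>%VS.
have LE M : M \in L -> exists s t, M = flatA T (s *: x + t *: y).
  rewrite /L span_cons span_seq1 => /memv_addP [_ /vlineP [s ->]].
  move=> [_ /vlineP [t ->] ->]; exists s, t.
  by rewrite linearD !linearZ.
exists L; split.
- suff /eqP -> : free [:: flatA T x; flatA T y] by [].
  rewrite free_cons span_seq1 seq1_free; apply/andP; split.
    by apply/vlineP => -[s]; rewrite -linearZ => /Tinj /eqP; apply/negP.
  by apply: contraNneq y0 => fy; apply/eqP/Tinj; rewrite fy linear0.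
- by move=> M /LE [s [t ->]]; exists (s *: x + t *: y).
move=> M /LE [s [t ->]] M0; have z0 : s *: x + t *: y != 0.
  by apply: contraNneq M0 => ->; rewrite linear0.
have [_ rk] := line s t z0; apply/eqP; rewrite eqn_leq rk.
by rewrite lt0n mxrank_eq0.
Qed.

Lemma geometric_rank_le r : (geometric_rank T <= codim_plus_rank T r)%N.
Proof.
rewrite /geometric_rank; case: ex_minnP => g _; apply.
by apply/asboolP; exists r.
Qed.

End RankLoci.

(** * The line of rank one matrices *)

Section Pencil.
Variables (K : closedFieldType) (a b c : nat) (T : tensor K a b c).

(** If the rank two locus has no longer chain than a given one in the rank one
    locus, then the top [X] of the latter contains its join with any of its
    points.  That the chain has two members or more provides two distinct points
    of [X]. *)
Lemma segre_pencil_of_chains k :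
  injective (flatA T) -> proj_chain (rank_locus T 1) k.+2 ->
  ~ proj_chain (rank_locus T 2) k.+3 ->
  exists L : {vspace 'M[K]_(b, c)},
    [/\ (1 < \dim L)%N,
        forall M, M \in L -> exists alpha, flatA T alpha = M
      & forall M, M \in L -> M != 0 -> segre M].
Proof.
move=> Tinj [Z [Zirr Zlt]] no_chain.
have [Z0irr Z0r] := Zirr ord0; have [Xirr Xr] := Zirr ord_max.
have [Z0X nXZ0] : (Z ord0 `<` Z ord_max)%classic by apply: Zlt.
set X := Z ord_max in Xirr Xr Z0X nXZ0.
have [Z0cl [x Z0x] _] := Z0irr; have [Xcl _ _] := Xirr.
have [y Xy nZ0y] : exists2 y, X y & ~ Z ord0 y.
  apply: contrapT => H; apply: nXZ0 => y Xy.
  by apply: contrapT => nZ; apply: H; exists y.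
have Xx := Z0X _ Z0x.
have [[x0 _] [y0 _]] := (Xr _ Xx, Xr _ Xy).
(* The join of x and X cannot be larger than X, for lack of a longer chain. *)
have WX : (hclosure (translates x X) `<=` X)%classic.
  apply: contrapT => nWX; apply: no_chain.
  apply: (proj_chain_rcons (X := rank_locus T 1)
    (W := hclosure (translates x X)) Zirr Zlt).
  - by move=> z [z0 zr]; split=> //; apply: leq_trans zr _.
  - apply: hclosure_irreducible y0; last first.
      by exists 0 => //; exists y; rewrite // scale0r add0r.
    exact/aff_irreducible_translates/proj_irreducible_aff.
  - apply: hclosure_min; first exact: rank_locus_closed.
    by rewrite -[2%N]/(1 + 1)%N; apply: translates_rank_locus => //; apply: Xr.
  - split=> // z Xz; apply: sub_hclosure; last by have [] := Xr _ Xz.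
    by exists 0 => //; exists z; rewrite // scale0r add0r.
apply: (segre_pencil (x := x) (y := y)) => //.
  move=> s; apply/eqP => xsy.
  have s0 : s != 0 by apply: contraNneq x0 => s0; rewrite xsy s0 scale0r.
  (* Proportional vectors represent the same point, so y would be in Z ord0. *)
  apply: nZ0y; have -> : y = s^-1 *: x by rewrite xsy scalerK.
  by apply: proj_closed_scale; rewrite ?invr_eq0.
(* For t = 0 the vector t *: y is the origin, which is not in X. *)
move=> s t z0; apply: Xr; have [t0|t0] := eqVneq t 0.
  move: z0; rewrite t0 scale0r addr0 scaler_eq0 negb_or => /andP [s0 _].
  exact: proj_closed_scale.
apply: WX; apply: sub_hclosure => //; exists s => //.
by exists (t *: y) => //; apply: proj_closed_scale.
Qed.

End Pencil.

Theorem corollary11 (R : realType) (m : nat) (T : tensor R[i] m m m)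
  (Tconcise : concise T)
  (Tdegenerate : degenerate_GR T)
  (only1 : forall r : nat, achieves_GR T r <-> r = 1%N) :
  exists L : {vspace 'M[R[i]]_(m, m)},
    [/\ (1 < \dim L)%N,
        forall M, M \in L -> exists alpha : 'rV[R[i]]_m, flatA T alpha = M
      & forall M, M \in L -> M != 0 -> segre M].
Proof.
have [Tinj _ _] := Tconcise.
have [k1 [chain1 codim1 _]] := proj_codim_chain (rank_locus T 1).
have [k2 [_ codim2 max2]] := proj_codim_chain (rank_locus T 2).
have GR1 : geometric_rank T = (m - k1 + 1)%N.
  by rewrite -codim1; apply/(only1 1%N).
(* The inequality is strict because r = 2 does not achieve the minimum. *)
have GR2 : (geometric_rank T < m - k2 + 2)%N.
  have := geometric_rank_le T 2; rewrite leq_eqVlt => /orP [/eqP /only1 //|].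
  by rewrite /codim_plus_rank codim2.
have k1m := proj_chain_le chain1.
move: Tdegenerate GR2; rewrite /degenerate_GR !minnn GR1 => lt_m lt2.
case: k1 chain1 k1m lt_m lt2 {codim1 GR1} => [|[|k]] chain1 k1m lt_m lt2.
- by move: lt_m; rewrite subn0 addn1 ltnNge leqnSn.
- by move: lt_m; rewrite subnK ?ltnn.
apply: (segre_pencil_of_chains Tinj chain1) => chain2.
have k2k := max2 _ chain2.
move: lt2; rewrite addn2 addn1 !ltnS leqNgt => /negP; apply.
exact: ltn_sub2l (proj_chain_le chain2) k2k.
Qed.
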